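(* Let $F \subset \mathbb{C}$ be an abelian number field and let $A = (F(\zeta_n)/F, \sigma_b, \zeta_n^c)$ be a cyclic cyclotomic algebra over $F$. Then $A$ has local index $2$ at an infinite prime of $F$ if and only if $F \subset \mathbb{R}$, $n > 2$, and $\zeta_n^c = -1$.
   Context: An abelian number field is a subfield $F$ of some cyclotomic field $\mathbb{Q}(\zeta_N) \subset \mathbb{C}$. For a positive integer $n$, $\zeta_n$ denotes a primitive complex $n$-th root of unity. Cyclic cyclotomic algebra: let $n \ge 1$, $b$, $c$ be integers with $b$ coprime to $n$ such that the extension $F(\zeta_n)/F$ is cyclic of degree $a = [F(\zeta_n):F]$, its Galois group is generated by the $F$-automorphism $\sigma_b$ with $\sigma_b(\zeta_n) = \zeta_n^b$, and $\zeta_n^c \in F$. Then $$(F(\zeta_n)/F, \sigma_b, \zeta_n^c) := \bigoplus_{i=0}^{a-1} F(\zeta_n)\, u^i,$$ where $u$ commutes with the elements of $F$, $u\zeta_n = \zeta_n^b u$, and $u^a = \zeta_n^c$. This is a central simple $F$-algebra. The Schur index of a central simple algebra $M_r(D)$ over a field $K$, with $D$ a division algebra with center $K$, is $\sqrt{[D:K]}$. The local index of $A$ at a (finite or infinite) prime $\mathcal{P}$ of $F$ is the Schur index of the central simple algebra $A \otimes_F F_{\mathcal{P}}$ over the completion $F_{\mathcal{P}}$. For cyclic cyclotomic algebras over an abelian number field, the local indices at all infinite primes of $F$ are equal (a known result of Benard and Schacher), so having local index $2$ at one infinite prime is the same as having it at every infinite prime. *)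

(* Defs.v *)
From HB Require Import structures.
From mathcomp Require Import all_boot all_order all_algebra all_fingroup.
From mathcomp Require Import all_solvable all_field.
From mathcomp Require Import complex.
From mathcomp Require Import boolp classical_sets reals topology normedtype.

Set Implicit Arguments.
Unset Strict Implicit.
Unset Printing Implicit Defensive.

Import Order.TTheory GRing.Theory Num.Theory.
Import numFieldNormedType.Exports.

Local Open Scope ring_scope.
Local Open Scope complex_scope.

(* F is the base field and E / F the extension; in E : splittingFieldType F the
   base field is the subfield 1%AS of E. *)
Definition cyclic_gen (F : fieldType) (E : splittingFieldType F)
    (s : gal_of {:E}) : bool :=
  galois 1 {:E} && generator 'Gal({:E} / 1) s.

Section CyclicAlgebra.
Variables (F : fieldType) (E : splittingFieldType F) (s : gal_of {:E}).

(* The cyclic algebra (E / F, s, g): the function x stands for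
   \sum_(i < [E : F]) x i u^i. *)
Definition cyclic_algebra (hs : cyclic_gen s) (g : F) : Type :=
  {ffun 'I_(\dim {:E}) -> E}.

Variables (hs : cyclic_gen s) (g : F).
Local Notation A := (cyclic_algebra hs g).
Local Notation a := (\dim {:E}).

HB.instance Definition _ := Vector.copy A {ffun 'I_a -> E}.

(* x u^m for arbitrary m, written in the basis (u^i)_(i < a) by u^a = g *)
Definition cyc_mono (x : E) (m : nat) : A :=
  [ffun k : 'I_a => if k == (m %% a)%N :> nat then x * (g ^+ (m %/ a))%:A else 0].

Definition cyc_one : A := cyc_mono 1 0.

(* (x u^i) (y u^j) = x s^i(y) u^(i + j) *)
Definition cyc_mul (x y : A) : A :=
  \sum_i \sum_j cyc_mono (x i * (s ^+ i)%g (y j)) (i + j).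

Let a_gt0 : (0 < a)%N. Proof. exact: adim_gt0. Qed.

Lemma cyc_gal_expD (i j : nat) x : (s ^+ (i + j))%g x = (s ^+ i)%g ((s ^+ j)%g x).
Proof. by rewrite addnC expgD galM ?memvf. Qed.

Lemma cyc_gal_exp_mod (i : nat) : (s ^+ (i %% a) = s ^+ i)%g.
Proof.
have /andP[galE /eqP genE] := hs.
have sa : (s ^+ a = 1)%g.
  have -> : a = #[s]%g.
    by rewrite /order -genE -(galois_dim galE) dimv1 divn1.
  exact: expg_order.
by rewrite {2}(divn_eq i a) expgD mulnC expgM sa expg1n mul1g.
Qed.

Lemma cyc_gal_alg (i : nat) (c : F) : (s ^+ i)%g c%:A = c%:A :> E.
Proof. by rewrite linearZ /= rmorph1. Qed.

Lemma cyc_monoD m : {morph cyc_mono^~ m : x y / x + y}.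
Proof.
move=> x y; apply/ffunP=> k; rewrite !ffunE.
by case: ifP => _; rewrite ?mulrDl ?addr0.
Qed.

Lemma cyc_mono0 m : cyc_mono 0 m = 0.
Proof. by apply/ffunP=> k; rewrite !ffunE mul0r if_same. Qed.

Lemma cyc_monoZ m c x : cyc_mono (c *: x) m = c *: cyc_mono x m.
Proof.
by apply/ffunP=> k; rewrite !ffunE; case: ifP => _; rewrite ?scaler0 ?scalerAl.
Qed.

Lemma cyc_mono_sum (I : finType) (f : I -> E) m :
  cyc_mono (\sum_i f i) m = \sum_i cyc_mono (f i) m.
Proof. exact: (big_morph (cyc_mono^~ m) (@cyc_monoD m) (cyc_mono0 m)). Qed.

Lemma cyc_sum (x : A) : x = \sum_i cyc_mono (x i) i.
Proof.
apply/ffunP=> k; rewrite sum_ffunE (bigD1 k) //= big1 => [|i /negPf ik].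
  by rewrite addr0 ffunE modn_small // eqxx divn_small // scale1r mulr1.
by rewrite ffunE modn_small // (inj_eq val_inj) eq_sym ik.
Qed.

Lemma cyc_mulDl : left_distributive cyc_mul +%R.
Proof.
move=> x y z; rewrite /cyc_mul -big_split; apply: eq_bigr => i _ /=.
rewrite -big_split; apply: eq_bigr => j _ /=.
by rewrite ffunE mulrDl cyc_monoD.
Qed.

Lemma cyc_mulDr : right_distributive cyc_mul +%R.
Proof.
move=> x y z; rewrite /cyc_mul -big_split; apply: eq_bigr => i _ /=.
rewrite -big_split; apply: eq_bigr => j _ /=.
by rewrite ffunE rmorphD mulrDr cyc_monoD.
Qed.

Lemma cyc_scalerAl c x y : c *: cyc_mul x y = cyc_mul (c *: x) y.
Proof.
rewrite /cyc_mul scaler_sumr; apply: eq_bigr => i _.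
rewrite scaler_sumr; apply: eq_bigr => j _.
by rewrite ffunE -cyc_monoZ scalerAl.
Qed.

Lemma cyc_scalerAr c x y : c *: cyc_mul x y = cyc_mul x (c *: y).
Proof.
rewrite /cyc_mul scaler_sumr; apply: eq_bigr => i _.
rewrite scaler_sumr; apply: eq_bigr => j _.
by rewrite ffunE -cyc_monoZ linearZ scalerAr.
Qed.

Lemma cyc_mul0l x : cyc_mul 0 x = 0.
Proof. by have := cyc_scalerAl 0 0 x; rewrite !scale0r => <-. Qed.

Lemma cyc_mul0r x : cyc_mul x 0 = 0.
Proof. by have := cyc_scalerAr 0 x 0; rewrite !scale0r => <-. Qed.

Lemma cyc_mul_suml (I : finType) (f : I -> A) y :
  cyc_mul (\sum_i f i) y = \sum_i cyc_mul (f i) y.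
Proof. exact: (big_morph (cyc_mul^~ y) (fun u v => cyc_mulDl u v y) (cyc_mul0l y)). Qed.

Lemma cyc_mul_sumr (I : finType) (f : I -> A) y :
  cyc_mul y (\sum_i f i) = \sum_i cyc_mul y (f i).
Proof. exact: (big_morph (cyc_mul y) (cyc_mulDr y) (cyc_mul0r y)). Qed.

Lemma cyc_mono_wrap x m p :
  cyc_mono (x * (g ^+ (m %/ a))%:A) (m %% a + p) = cyc_mono x (m + p).
Proof.
apply/ffunP=> k; rewrite !ffunE modnDml; case: ifP => // _.
rewrite -mulrA -scalerAl mul1r scalerA -exprD; congr (_ * (g ^+ _)%:A).
by rewrite {3}(divn_eq m a) -addnA divnMDl.
Qed.

Lemma cyc_mul_mono x m y p :
  cyc_mul (cyc_mono x m) (cyc_mono y p) = cyc_mono (x * (s ^+ m)%g y) (m + p).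
Proof.
pose om := Ordinal (ltn_pmod m a_gt0); pose op := Ordinal (ltn_pmod p a_gt0).
rewrite /cyc_mul (bigD1 om) //= [X in _ + X]big1 => [|i /negPf im]; last first.
  apply: big1 => j _; rewrite ffunE -[(m %% a)%N]/(val om) (inj_eq val_inj) im.
  by rewrite mul0r cyc_mono0.
rewrite addr0 (bigD1 op) //= big1 => [|j /negPf jp]; last first.
  rewrite [cyc_mono y p j]ffunE -[(p %% a)%N]/(val op) (inj_eq val_inj) jp.
  by rewrite rmorph0 mulr0 cyc_mono0.
rewrite addr0 !ffunE !eqxx cyc_gal_exp_mod rmorphM /= cyc_gal_alg.
rewrite mulrACA [_%:A * _]mulrC mulrA cyc_mono_wrap addnC cyc_mono_wrap.
by rewrite addnC.
Qed.

Lemma cyc_mulA : associative cyc_mul.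
Proof.
move=> x y z; rewrite (cyc_sum x) !cyc_mul_suml; apply: eq_bigr => i _.
rewrite (cyc_sum y) cyc_mul_suml !cyc_mul_sumr cyc_mul_suml.
apply: eq_bigr => j _; rewrite (cyc_sum z) !cyc_mul_sumr.
apply: eq_bigr => k _.
by rewrite !cyc_mul_mono rmorphM /= -cyc_gal_expD mulrA addnA.
Qed.

Lemma cyc_mul1l : left_id cyc_one cyc_mul.
Proof.
move=> x; rewrite [in LHS](cyc_sum x) cyc_mul_sumr [RHS]cyc_sum.
by apply: eq_bigr => i _; rewrite cyc_mul_mono expg0 gal_id mul1r.
Qed.

Lemma cyc_mul1r : right_id cyc_one cyc_mul.
Proof.
move=> x; rewrite [in LHS](cyc_sum x) cyc_mul_suml [RHS]cyc_sum.
by apply: eq_bigr => i _; rewrite cyc_mul_mono rmorph1 mulr1 addn0.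
Qed.

Lemma cyc_one_neq0 : cyc_one != 0.
Proof.
apply/eqP => /ffunP/(_ (Ordinal a_gt0)) /eqP; rewrite !ffunE mod0n /= div0n.
by rewrite scale1r mulr1 oner_eq0.
Qed.

HB.instance Definition _ := GRing.Zmodule_isNzRing.Build A
  cyc_mulA cyc_mul1l cyc_mul1r cyc_mulDl cyc_mulDr cyc_one_neq0.
HB.instance Definition _ := GRing.Lmodule_isLalgebra.Build F A cyc_scalerAl.
HB.instance Definition _ := GRing.Lalgebra_isAlgebra.Build F A cyc_scalerAr.
HB.instance Definition _ := Algebra_isFalgebra.Build F A.

End CyclicAlgebra.

Section BaseChange.
Variables (F K : fieldType) (f : {rmorphism F -> K}) (A : falgType F).

(* A \otimes_F K, K being an F-algebra through f: the K-vector space on the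
   F-basis e = vbasis {:A} of A, with the structure constants of A. *)
Definition base_change (f : F -> K) (A : falgType F) : Type :=
  'rV[K]_(\dim {:A}).

Local Notation AK := (base_change f A).
Local Notation e := (vbasis {:A}).

HB.instance Definition _ := Vector.copy AK 'rV[K]_(\dim {:A}).

(* v \otimes 1 *)
Definition bc_in (v : A) : AK := \row_i f (coord e i v).

Definition bc_mul (x y : AK) : AK :=
  \sum_i \sum_j (x 0 i * y 0 j) *: bc_in (e`_i * e`_j).

Lemma bc_inD : {morph bc_in : v w / v + w}.
Proof. by move=> v w; apply/rowP=> i; rewrite !mxE linearD rmorphD. Qed.

Lemma bc_inZ c v : bc_in (c *: v) = f c *: bc_in v.
Proof. by apply/rowP=> i; rewrite !mxE linearZ rmorphM. Qed.

Lemma bc_in0 : bc_in 0 = 0.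
Proof. by apply/rowP=> i; rewrite !mxE linear0 rmorph0. Qed.

Lemma bc_in_sum (I : finType) (h : I -> A) :
  bc_in (\sum_i h i) = \sum_i bc_in (h i).
Proof. exact: (big_morph bc_in bc_inD bc_in0). Qed.

Lemma bc_in_basis (i : 'I_(\dim {:A})) : bc_in e`_i = delta_mx 0 i.
Proof.
apply/rowP=> j; rewrite !mxE /= coord_free ?(basis_free (vbasisP _)) //.
by rewrite rmorph_nat eq_sym.
Qed.

Lemma bc_sum (x : AK) : x = \sum_i x 0 i *: bc_in e`_i.
Proof.
by rewrite {1}(row_sum_delta x); apply: eq_bigr => i _; rewrite bc_in_basis.
Qed.

Lemma bc_mulDl : left_distributive bc_mul +%R.
Proof.
move=> x y z; rewrite /bc_mul -big_split; apply: eq_bigr => i _ /=.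
rewrite -big_split; apply: eq_bigr => j _ /=.
by rewrite mxE mulrDl scalerDl.
Qed.

Lemma bc_mulDr : right_distributive bc_mul +%R.
Proof.
move=> x y z; rewrite /bc_mul -big_split; apply: eq_bigr => i _ /=.
rewrite -big_split; apply: eq_bigr => j _ /=.
by rewrite mxE mulrDr scalerDl.
Qed.

Lemma bc_scalerAl c x y : c *: bc_mul x y = bc_mul (c *: x) y.
Proof.
rewrite /bc_mul scaler_sumr; apply: eq_bigr => i _.
rewrite scaler_sumr; apply: eq_bigr => j _.
by rewrite mxE scalerA mulrA.
Qed.

Lemma bc_scalerAr c x y : c *: bc_mul x y = bc_mul x (c *: y).
Proof.
rewrite /bc_mul scaler_sumr; apply: eq_bigr => i _.
rewrite scaler_sumr; apply: eq_bigr => j _.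
by rewrite mxE scalerA mulrCA.
Qed.

Lemma bc_mul0l x : bc_mul 0 x = 0.
Proof. by have := bc_scalerAl 0 0 x; rewrite !scale0r => <-. Qed.

Lemma bc_mul0r x : bc_mul x 0 = 0.
Proof. by have := bc_scalerAr 0 x 0; rewrite !scale0r => <-. Qed.

Lemma bc_mul_suml (I : finType) (h : I -> AK) y :
  bc_mul (\sum_i h i) y = \sum_i bc_mul (h i) y.
Proof. exact: (big_morph (bc_mul^~ y) (fun u v => bc_mulDl u v y) (bc_mul0l y)). Qed.

Lemma bc_mul_sumr (I : finType) (h : I -> AK) y :
  bc_mul y (\sum_i h i) = \sum_i bc_mul y (h i).
Proof. exact: (big_morph (bc_mul y) (bc_mulDr y) (bc_mul0r y)). Qed.

Lemma bc_inM : {morph bc_in : v w / v * w >-> bc_mul v w}.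
Proof.
move=> v w; rewrite {1}(coord_vbasis (memvf v)) {1}(coord_vbasis (memvf w)).
rewrite mulr_suml bc_in_sum /bc_mul; apply: eq_bigr => i _.
rewrite mulr_sumr bc_in_sum; apply: eq_bigr => j _.
by rewrite -scalerAl -scalerAr !bc_inZ scalerA !mxE.
Qed.

Lemma bc_mul_suml_basis x y :
  bc_mul x y = \sum_i x 0 i *: bc_mul (bc_in e`_i) y.
Proof.
rewrite {1}(bc_sum x) bc_mul_suml.
by apply: eq_bigr => i _; rewrite bc_scalerAl.
Qed.

Lemma bc_mul_sumr_basis x y :
  bc_mul x y = \sum_i y 0 i *: bc_mul x (bc_in e`_i).
Proof.
rewrite {1}(bc_sum y) bc_mul_sumr.
by apply: eq_bigr => i _; rewrite bc_scalerAr.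
Qed.

Lemma bc_mulA : associative bc_mul.
Proof.
have A1 v w z :
    bc_mul (bc_in v) (bc_mul (bc_in w) z) = bc_mul (bc_in (v * w)) z.
  rewrite [RHS]bc_mul_sumr_basis [bc_mul (bc_in w) z]bc_mul_sumr_basis.
  rewrite bc_mul_sumr; apply: eq_bigr => k _.
  by rewrite -bc_scalerAr -bc_inM -bc_inM -bc_inM mulrA.
have A2 v y z : bc_mul (bc_in v) (bc_mul y z) = bc_mul (bc_mul (bc_in v) y) z.
  rewrite [bc_mul y z]bc_mul_suml_basis bc_mul_sumr.
  rewrite [bc_mul (bc_in v) y]bc_mul_sumr_basis bc_mul_suml.
  by apply: eq_bigr => j _; rewrite -bc_scalerAr -bc_scalerAl A1 bc_inM.
move=> x y z; rewrite [LHS]bc_mul_suml_basis [bc_mul x y]bc_mul_suml_basis.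
rewrite bc_mul_suml; apply: eq_bigr => i _.
by rewrite A2 -bc_scalerAl.
Qed.

Lemma bc_mul1l : left_id (bc_in 1) bc_mul.
Proof.
move=> x; rewrite {1}(bc_sum x) bc_mul_sumr [RHS]bc_sum.
by apply: eq_bigr => i _; rewrite -bc_scalerAr -bc_inM mul1r.
Qed.

Lemma bc_mul1r : right_id (bc_in 1) bc_mul.
Proof.
move=> x; rewrite {1}(bc_sum x) bc_mul_suml [RHS]bc_sum.
by apply: eq_bigr => i _; rewrite -bc_scalerAl -bc_inM mulr1.
Qed.

Lemma bc_one_neq0 : bc_in 1 != 0.
Proof.
apply/eqP => /rowP bc10; have := oner_neq0 A; apply/negP; rewrite negbK.
rewrite (coord_vbasis (memvf 1)) big1 // => i _.
by have /eqP := bc10 i; rewrite !mxE fmorph_eq0 => /eqP ->; rewrite scale0r.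
Qed.

HB.instance Definition _ := GRing.Zmodule_isNzRing.Build AK
  bc_mulA bc_mul1l bc_mul1r bc_mulDl bc_mulDr bc_one_neq0.
HB.instance Definition _ := GRing.Lmodule_isLalgebra.Build K AK bc_scalerAl.
HB.instance Definition _ := GRing.Lalgebra_isAlgebra.Build K AK bc_scalerAr.
HB.instance Definition _ := Algebra_isFalgebra.Build K AK.

End BaseChange.

Section Completion.
Variables (R : realType) (F : fieldType) (v : {rmorphism F -> R[i]}).

(* An infinite prime of F is represented by a complex embedding v, up to
   conjugation.  As R[i] is complete, the completion of F for the absolute
   value `|v x| is the topological closure of v(F) in R[i].  (R[i]^o carries
   the topology of the norm.) *)
Definition in_completion (v : F -> R[i]) : {pred R[i]} :=
  fun x => `[< closure (range v : set R[i]^o) x >].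

Lemma in_completion_im (x : F) : v x \in in_completion v.
Proof. by apply/asboolP; apply: subset_closure; exists x. Qed.

Lemma in_completion_op1 (o : R[i]^o -> R[i]^o) (o' : F -> F) x :
    {for x, continuous o} -> (forall y, v (o' y) = o (v y)) ->
  x \in in_completion v -> o x \in in_completion v.
Proof.
move=> co oE /asboolP cx; apply/asboolP => B /co /cx [_ [[y _ <-] By]].
by exists (o (v y)); split=> //; exists (o' y).
Qed.

Lemma in_completion_op2 (o : R[i]^o * R[i]^o -> R[i]^o) (o' : F -> F -> F) x y :
    {for (x, y), continuous o} -> (forall z t, v (o' z t) = o (v z, v t)) ->
  x \in in_completion v -> y \in in_completion v -> o (x, y) \in in_completion v.
Proof.
move=> co oE /asboolP cx /asboolP cy; apply/asboolP => B /co [[B1 B2] /= []].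
move=> /cx [_ [[z _ <-] Bz]] /cy [_ [[t _ <-] Bt]] sB.
by exists (o (v z, v t)); split; [exists (o' z t) | apply: sB].
Qed.

Lemma in_completion_divring : divring_closed (in_completion v).
Proof.
split=> [|x y xc yc|x y xc yc].
- by rewrite -(rmorph1 v) in_completion_im.
- apply: (@in_completion_op2 (fun z => z.1 - z.2) (fun z t => z - t)) xc yc.
    by apply: cvgB; [apply: cvg_fst | apply: cvg_snd].
  by move=> z t; rewrite rmorphB.
have yVc : y^-1 \in in_completion v.
  have [->|y0] := eqVneq y 0; first by rewrite invr0 -(rmorph0 v) in_completion_im.
  apply: (@in_completion_op1 GRing.inv GRing.inv) yc; last exact: fmorphV.
  exact: inv_continuous.
apply: (@in_completion_op2 (fun z => z.1 * z.2) (fun z t => z * t)) xc yVc.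
  by apply: mul_continuous.
by move=> z t; rewrite rmorphM.
Qed.

HB.instance Definition _ :=
  GRing.isDivringClosed.Build R[i] (in_completion v) in_completion_divring.

Definition completion : Type := {x : R[i] | in_completion v x}.

HB.instance Definition _ := SubChoice.on completion.
HB.instance Definition _ :=
  [SubChoice_isSubIntegralDomain of completion by <:].
HB.instance Definition _ :=
  [SubIntegralDomain_isSubField of completion by <:].

Definition completion_in (x : F) : completion := Sub (v x) (in_completion_im x).

Lemma completion_in_zmod : zmod_morphism completion_in.
Proof. by move=> x y; apply: val_inj; rewrite /= rmorphB. Qed.

Lemma completion_in_monoid : monoid_morphism completion_in.
Proof.
by split=> [|x y]; apply: val_inj; rewrite /= ?rmorph1 ?rmorphM.
Qed.

HB.instance Definition _ :=
  GRing.isZmodMorphism.Build F completion completion_in completion_in_zmod.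
HB.instance Definition _ :=
  GRing.isMonoidMorphism.Build F completion completion_in completion_in_monoid.

End Completion.

(* B is isomorphic as a K-algebra to M_(r+1)(D), where D is a division algebra
   with centre K and sqrt [D : K] = m. *)
Definition schur_index (K : fieldType) (B : falgType K) (m : nat) : Prop :=
  exists (r : nat) (D : falgType K) (phi : {rmorphism B -> 'M[D]_r.+1}),
    [/\ forall d : D, d != 0 -> d \is a GRing.unit,
        forall d : D, (forall d', d * d' = d' * d) -> exists k : K, d = k%:A,
        bijective phi,
        forall k : K, phi k%:A = (k%:A)%:M
      & \dim {:D} = (m ^ 2)%N].

Definition local_index (R : realType) (F : fieldType) (A : falgType F)
    (v : {rmorphism F -> R[i]}) (m : nat) : Prop :=
  schur_index (base_change (completion_in v) A) m.

(* The subfield iota(F) of R[i] is contained in Q(zeta_N) for some N >= 1. *)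
Definition abelian_number_field (R : realType) (F : fieldType)
    (iota : F -> R[i]) : Prop :=
  exists (N : nat) (w : R[i]), N.-primitive_root w /\
    forall x : F, exists p : {poly rat}, iota x = (map_poly ratr p).[w].

(* Main.v *)
Require Import Defs.
From HB Require Import structures.
From mathcomp Require Import all_boot all_order all_algebra all_fingroup.
From mathcomp Require Import all_solvable all_field.
From mathcomp Require Import complex ring.
From mathcomp Require Import boolp classical_sets reals topology normedtype.

Set Implicit Arguments.
Unset Strict Implicit.
Unset Printing Implicit Defensive.

Import Order.TTheory GRing.Theory Num.Theory.
Import numFieldNormedType.Exports.

Local Open Scope ring_scope.
Local Open Scope complex_scope.

(* The completion of F at v is R or C according to whether v(F) is real.  Over
   C every division algebra is trivial, so local index 2 forces v(F) to be
   real; as F is abelian, complex conjugation commutes with all embeddings and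
   F itself is real.  Then zeta_n^c is a real root of unity, and it is not 1:
   otherwise the left ideal A (1 + u + ... + u^(a-1)) has dimension a, which is
   too small in matrices over a quaternion algebra.

   Conversely, if F is real and n > 2, complex conjugation is an element of
   order 2 of the cyclic group Gal(F(zeta_n) / F), so it is sigma^m with
   a = 2 m.  With H = C + C j the quaternions, mapping x to
   diag (x, sigma x, ..., sigma^(m-1) x) and u to the cyclic shift with j in
   its corner defines a morphism from A to M_m(H), because j x = conj x j and
   u^m goes to j.  Independence of the sigma^i makes it injective after
   extension of scalars, and both sides have dimension a^2. *)

(** * The completion at an infinite prime is R or C *)

Section CompletionField.
Variables (R : realType) (F : fieldType) (v : {rmorphism F -> R[i]}).

(** Every rational is in v(F), and the rationals are dense in R. *)
Lemma real_in_completion (r : R) : r%:C \in in_completion v.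
Proof.
apply/asboolP => B /nbhs_ballP [e /= e0 sB].
have : r < r + complex.Re e.
  by rewrite ltrDl; move: e0; rewrite ltcE => /andP[_].
move=> /rat_in_itvoo [q]; rewrite in_itv /= => /andP[rq qr].
exists (ratr q); split; first by exists (ratr q) => //; rewrite fmorph_rat.
apply: sB; rewrite /ball /= /ball_ /=.
have -> : ratr q = (ratr q)%:C :> R[i] by rewrite fmorph_rat.
rewrite distrC -rmorphB /=.
have -> : e = (complex.Re e)%:C by rewrite RRe_real // gtr0_real.
have -> : `|(ratr q - r)%:C| = `|ratr q - r|%:C :> R[i].
  by rewrite normc_def /= expr0n addr0 sqrtr_sqr.
by rewrite ltcR gtr0_norm ?subr_gt0 // ltrBlDl.
Qed.

(** A nonreal x has distance at least |Im x| from every real number, so it is not a limit of real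
    values of [v]. *)
Lemma in_completion_real : (forall x, v x \is Num.real) ->
  forall x, x \in in_completion v -> x \is Num.real.
Proof.
move=> vR x /asboolP cx; apply/negPn/negP => xR.
have Imx : complex.Im x != 0 by case: x {cx} xR => a b; rewrite complex_real.
have e0 : 0 < `|complex.Im x|%:C :> R[i] by rewrite ltcR normr_gt0.
have /cx [_ [[y _ <-]]] :
    nbhs (x : R[i]^o) (ball (x : R[i]^o) `|complex.Im x|%:C).
  exact: nbhsx_ballx.
rewrite /ball /= /ball_ /=; have /complex_realP [k ->] := vR y.
case: x {cx xR e0} Imx => a b /= b0.
rewrite normc_def /= oppr0 addr0 ltcR; apply/negP; rewrite -leNgt.
by rewrite -(sqrtr_sqr b) ler_wsqrtr // lerDr sqr_ge0.
Qed.

Lemma in_completion_full x : v x \isn't Num.real ->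
  forall y, y \in in_completion v.
Proof.
move=> xR y; case E: (v x) xR => [p q]; rewrite complex_real => q0.
case: y => c d.
(* As p + i q is not real, it spans C over R together with 1; the coefficients solve c + i d = t + k
   (p + i q). *)
have -> : c +i* d = (c - d / q * p)%:C + (d / q)%:C * v x.
  by rewrite E; simpc; rewrite subrK divfK.
by rewrite rpredD ?rpredM ?real_in_completion ?in_completion_im.
Qed.

End CompletionField.

(** * Transport of reality from one embedding of an abelian field to another *)

Section Conjugates.
Variables (F K : fieldType).
Implicit Types (f : {rmorphism F -> K}) (p q : {poly F}) (w : K).

(** Strong induction on the size: in a proper factorization of [p] one of the factors still vanishes
    at [w]. The result plays the role of the minimal polynomial of [w] over f(F). *)
Lemma irreducible_annihilator f p w :
  p != 0 -> root (map_poly f p) w ->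
  exists2 q, irreducible_poly q & root (map_poly f q) w.
Proof.
have [k] := ubnP (size p); elim: k p => // k IHk p /ltnSE sp p0 pw.
have sp1 : (1 < size p)%N.
  rewrite ltnNge; apply/negP => /size1_polyC pE; move: p0 pw.
  by rewrite pE map_polyC /= polyC_eq0 /root hornerC fmorph_eq0 => /negPf ->.
case: (pselect (irreducible_poly p)) => [irr|]; first by exists p.
case/not_andP => [/(_ sp1)//|/existsNP[q /not_implyP[q1 /not_implyP[dqp nqp]]]].
have /dvdpP [r pE] := dqp.
have /andP[r0 q0] : (r != 0) && (q != 0) by rewrite -negb_or -mulf_eq0 -pE.
have q_gt1 : (1 < size q)%N by rewrite ltn_neqAle eq_sym q1 size_poly_gt0.
have sq : (size q < size p)%N.
  by rewrite ltn_neqAle dvdp_leq // andbT (dvdp_size_eqp dqp); apply/negP.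
have sr : (size r < size p)%N.
  by rewrite pE size_mul // -subn1 ltn_subRL addnC ltn_add2l.
move: pw; rewrite pE rmorphM rootM => /orP[] rw.
  by apply: IHk rw => //; apply: leq_trans sr sp.
by apply: IHk rw => //; apply: leq_trans sq sp.
Qed.

(** If [p] and [q] were coprime, a Bezout relation evaluated at [w] would give 0 = 1. *)
Lemma irreducible_dvd f p q w : irreducible_poly p ->
  root (map_poly f p) w -> root (map_poly f q) w -> p %| q.
Proof.
move=> irr /rootP pw /rootP qw.
have [/Bezout_eq1_coprimepP|] := boolP (coprimep p q).
  case=> -[a b] /= /(congr1 (fun r => (map_poly f r).[w])) /eqP.
  rewrite rmorphD !rmorphM rmorph1 !hornerE pw qw !mulr0 addr0.
  by rewrite eq_sym oner_eq0.
move=> g1; have /eqp_dvdl <- := apply_irredp irr g1 (dvdp_gcdl _ _).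
exact: dvdp_gcdr.
Qed.

End Conjugates.

Lemma norm_unity_root (C : numDomainType) N (w : C) :
  (0 < N)%N -> w ^+ N = 1 -> `|w| = 1.
Proof.
by move=> N0 wN; apply/eqP; rewrite -(@pexpr_eq1 _ _ N) // -normrX wN normr1.
Qed.

(** On roots of unity conjugation becomes a polynomial map, which every embedding respects. *)
Lemma conj_unity_root (C : numClosedFieldType) N (w : C) :
  w ^+ N = 1 -> (0 < N)%N -> (w^*)%R = w ^+ N.-1.
Proof.
move=> wN N0; have w0 : w != 0.
  apply/eqP => w0; move/eqP: wN.
  by rewrite w0 expr0n gtn_eqF // eq_sym oner_eq0.
apply: (mulfI w0); rewrite -exprS prednK // wN.
by rewrite -normCK (norm_unity_root N0 wN) expr1n.
Qed.

(* If m in F[X] is the minimal polynomial of w over i(F) and w' is a root of the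
   image of m under v, then i x = p(w) gives v x = p(w'), and as w and w' are
   roots of unity the reality of p(w), p(w') is the vanishing of
   p(X^(N-1)) - p there. *)
Lemma abelian_conjugate_real (C : numClosedFieldType) (F : fieldExtType rat)
    (i v : {rmorphism F -> C}) N (w : C) :
  N.-primitive_root w ->
  (forall x, exists p : {poly rat}, i x = (map_poly ratr p).[w]) ->
  forall x, v x \is Num.real -> i x \is Num.real.
Proof.
move=> prw iE x; have N0 := prim_order_gt0 prw.
have ratE (f : {rmorphism F -> C}) (p : {poly rat}) :
    map_poly f (map_poly (in_alg F) p) = map_poly ratr p.
  rewrite -map_poly_comp; apply: eq_map_poly => q.
  by rewrite (fmorph_eq_rat (f \o in_alg F)).
pose q0 : {poly F} := 'X^N - 1.
have q0E (f : {rmorphism F -> C}) y : root (map_poly f q0) y = (y ^+ N == 1).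
  by rewrite rmorphB rmorph1 /= map_polyXn /root !hornerE subr_eq0.
have [] := @irreducible_annihilator F C i q0 w.
- by rewrite -size_poly_eq0 size_XnsubC.
- by rewrite q0E prim_expr_order.
move=> m irr mw.
have /closed_rootP [w' mw'] : size (map_poly v m) != 1.
  by rewrite size_map_poly neq_ltn; case: irr => -> _; rewrite orbT.
have w_w' q : root (map_poly i q) w -> root (map_poly v q) w'.
  move=> /(irreducible_dvd irr mw) /dvdpP[r ->].
  by rewrite rmorphM rootM mw' orbT.
have w'_w q : root (map_poly v q) w' -> root (map_poly i q) w.
  move=> /(irreducible_dvd irr mw') /dvdpP[r ->].
  by rewrite rmorphM rootM mw orbT.
have wN : w ^+ N = 1 by apply: prim_expr_order.
have w'N : w' ^+ N = 1 by apply/eqP; rewrite -(q0E v) w_w' // q0E wN.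
have [p xE] := iE x.
have vxE : v x = (map_poly ratr p).[w'].
  have := w_w' (map_poly (in_alg F) p - x%:P).
  rewrite !rmorphB /= !map_polyC !ratE /= /root !hornerE -xE subrr eqxx.
  by move=> /(_ isT); rewrite subr_eq0 => /eqP.
(* Conjugation fixes the rational coefficients of [p] and only replaces [y] by [y ^+ N.-1]. *)
have conjE y : y ^+ N = 1 ->
    ((map_poly ratr p).[y]^* = (map_poly ratr (p \Po 'X^(N.-1))).[y] :> C)%R.
  move=> yN; rewrite -horner_map -map_poly_comp map_comp_poly map_polyXn.
  rewrite horner_comp hornerXn -(conj_unity_root yN N0); congr _.[_].
  by apply: eq_map_poly => q; rewrite /= fmorph_rat.
have realE (f : {rmorphism F -> C}) y : y ^+ N = 1 ->
    ((map_poly ratr p).[y] \is Num.real) =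
    root (map_poly f (map_poly (in_alg F) (p \Po 'X^(N.-1) - p))) y.
  move=> yN; rewrite CrealE conjE // ratE /root rmorphB hornerD hornerN.
  by rewrite subr_eq0.
by rewrite xE vxE (realE i w) // (realE v w') //; apply: w'_w.
Qed.

(** * Dimension counts for linear maps *)

Section LinearDim.
Variables (K : fieldType) (V W : vectType K) (f : {linear V -> W}).

Lemma inj_dim_le (U : {vspace W}) : injective f -> (forall x, f x \in U) ->
  (\dim {:V} <= \dim U)%N.
Proof.
move=> injf fU; have k0 : lker (linfun f) == 0%VS.
  by apply/lker0P => x y; rewrite !lfunE => /injf.
rewrite -(limg_dim_eq (f := linfun f)) ?(eqP k0) ?capv0 //.
by apply/dimvS/subvP => _ /memv_imgP[x _ ->]; rewrite lfunE fU.
Qed.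

Lemma bij_dim : bijective f -> \dim {:V} = \dim {:W}.
Proof.
case=> g fK gK; have k0 : lker (linfun f) == 0%VS.
  by apply/lker0P => x y; rewrite !lfunE => /(can_inj fK).
rewrite -(limg_dim_eq (f := linfun f)) ?(eqP k0) ?capv0 //; congr (\dim _).
apply/eqP; rewrite eqEsubv subvf; apply/subvP => y _.
by rewrite -(gK y) -(lfunE f) memv_img ?memvf.
Qed.

Lemma inj_eqdim_bij : injective f -> \dim {:V} = \dim {:W} -> bijective f.
Proof.
move=> injf eqd; have k0 : lker (linfun f) == 0%VS.
  by apply/lker0P => x y; rewrite !lfunE => /injf.
have fE : f =1 linfun f by move=> x; rewrite lfunE.
apply: (eq_bij _ (fsym fE)).
exists (linfun f)^-1%VF; first exact: lker0_lfunK.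
move=> y; rewrite limg_lfunVK //.
suff -> : limg (linfun f) = fullv by exact: memvf.
by apply/eqP; rewrite eqEdim subvf limg_dim_eq ?(eqP k0) ?capv0 //= eqd.
Qed.

End LinearDim.

(** * Division algebras over an algebraically closed field *)

Section ClosedDivisionAlgebra.
Import VectorInternalTheory.

Lemma closed_eigenvector (K : fieldType) (V : vectType K) (f : 'End(V)) :
    (forall p : {poly K}, size p != 1 -> exists x, root p x) ->
    (0 < \dim {:V})%N ->
  exists k, exists2 x, x != 0 & f x = k *: x.
Proof.
move=> closK; rewrite dimvf => V0.
have [|k] := closK (char_poly (f2mx f)).
  by rewrite size_char_poly eqSS -lt0n.
rewrite -eigenvalue_root_char => /eigenvalueP[v vf v0]; exists k, (r2v v).
  by apply: contraNneq v0 => /(congr1 v2r); rewrite r2vK linear0 => ->.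
by rewrite unlock /= r2vK vf linearZ.
Qed.

(** Left multiplication by d has an eigenvector x; cancelling the unit x in d x = k x gives d =
    k. *)
Lemma closed_division_dim (K : fieldType) (D : falgType K) :
    (forall p : {poly K}, size p != 1 -> exists x, root p x) ->
    (forall d : D, d != 0 -> d \is a GRing.unit) ->
  \dim {:D} = 1%N.
Proof.
move=> closK divD; suff -> : {:D}%VS = 1%VS by exact: dimv1.
apply/eqP; rewrite eqEsubv subvf andbT; apply/subvP => d _.
have [k [x x0]] := closed_eigenvector (amull d) closK (adim_gt0 _).
rewrite lfunE /= -mulr_algl => /(mulIr (divD x x0)) ->.
by rewrite memvZ ?memv_line.
Qed.

End ClosedDivisionAlgebra.

(** * Dimensions and left ideals in matrices over a division algebra *)

Section MatrixAlgebra.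
Variables (K : fieldType) (B D : falgType K) (r : nat).
Variable phi : {rmorphism B -> 'M[D]_r.+1}.
Hypothesis phi_alg : forall k : K, phi k%:A = (k%:A)%:M.
Local Notation entries := {ffun 'I_r.+1 * 'I_r.+1 -> D}.

Lemma matrix_algebraZ k y i j : phi (k *: y) i j = k *: phi y i j.
Proof.
by rewrite -mulr_algl rmorphM phi_alg -mulmxE mul_scalar_mx mxE mulr_algl.
Qed.

(** Matrices over [D] have their scalars in [D], while dimensions are counted over [K]; the family
    of entries carries the K-linear structure. *)
Definition mx_entries (y : B) : entries := [ffun ij => phi y ij.1 ij.2].

Lemma mx_entries_linear : linear mx_entries.
Proof.
by move=> k x y; apply/ffunP => ij; rewrite !ffunE rmorphD mxE matrix_algebraZ.
Qed.

HB.instance Definition _ :=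
  GRing.isLinear.Build K B entries *:%R mx_entries mx_entries_linear.

Let mx_of (d : entries) : 'M[D]_r.+1 := \matrix_(i, j) d (i, j).

Let mx_entriesK y : mx_of (mx_entries y) = phi y.
Proof. by apply/matrixP => i j; rewrite mxE ffunE. Qed.

Let mx_of_inj : injective mx_of.
Proof.
move=> d d' /matrixP dd'; apply/ffunP => -[i j].
by have := dd' i j; rewrite !mxE.
Qed.

Lemma dim_entries : \dim {:entries} = (r.+1 ^ 2 * \dim {:D})%N.
Proof. by rewrite !dimvf /dim /= card_prod card_ord. Qed.

Lemma dim_matrix_algebra :
  bijective phi -> \dim {:B} = (r.+1 ^ 2 * \dim {:D})%N.
Proof.
case=> psi phiK psiK; rewrite -dim_entries; apply: (@bij_dim _ _ _ mx_entries).
exists (psi \o mx_of) => [y|d] /=; first by rewrite mx_entriesK phiK.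
by apply: mx_of_inj; rewrite mx_entriesK psiK.
Qed.

Lemma inj_matrix_algebra_bij :
  injective phi -> \dim {:B} = (r.+1 ^ 2 * \dim {:D})%N -> bijective phi.
Proof.
move=> injphi; rewrite -dim_entries => /inj_eqdim_bij dimB.
have [|h hK Kh] := dimB mx_entries.
  by move=> x y /(congr1 mx_of); rewrite !mx_entriesK => /injphi.
have of_entries (M : 'M[D]_r.+1) : mx_of [ffun ij => M ij.1 ij.2] = M.
  by apply/matrixP => i j; rewrite mxE ffunE.
exists (fun M : 'M[D]_r.+1 => h [ffun ij => M ij.1 ij.2]) => [y|M].
  exact: hK.
by rewrite -mx_entriesK Kh of_entries.
Qed.

(** Fix a nonzero entry (i, j) of [phi x]. The matrix with column i equal to d and zeros elsewhere,
    multiplied by [phi x], has column j equal to d times that entry. So d is recovered, and D^(r+1)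
    embeds in the left ideal of [x]. *)
Lemma dim_left_ideal_ge (U : {vspace B}) (x : B) :
    bijective phi -> (forall d : D, d != 0 -> d \is a GRing.unit) ->
    x != 0 -> (forall y, y * x \in U) ->
  (r.+1 * \dim {:D} <= \dim U)%N.
Proof.
case=> psi phiK psiK divD x0 xU.
have /matrix0Pn [i [j xij]] : phi x != 0.
  by apply: contraNneq x0 => px0; rewrite -(phiK x) px0 -(rmorph0 phi) phiK.
pose c (d : {ffun 'I_r.+1 -> D}) :=
  \matrix_(k, l) (if l == i then d k else 0) : 'M[D]_r.+1.
pose f d := psi (c d) * x.
have phif d k : phi (f d) k j = d k * phi x i j.
  rewrite rmorphM psiK -mulmxE mxE (bigD1 i) //= mxE eqxx.
  rewrite big1 ?addr0 // => l /negPf li.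
  by rewrite mxE li mul0r.
have linf : linear f.
  move=> k d d'; rewrite /f scalerAl -mulrDl; congr (_ * x).
  rewrite -[RHS]phiK; congr psi; apply/matrixP => m l.
  rewrite rmorphD [RHS]mxE matrix_algebraZ !psiK !mxE !ffunE.
  by case: eqP => // _; rewrite scaler0 addr0.
pose F : {linear _ -> _} := HB.pack f (GRing.isLinear.Build _ _ _ _ f linf).
suff : (\dim {:{ffun 'I_r.+1 -> D}} <= \dim U)%N.
  by rewrite !dimvf /dim /= card_ord.
apply: (@inj_dim_le _ _ _ F) => [d d' /(congr1 phi)|d]; last exact: xU.
move=> /matrixP fdd'.
apply/ffunP => k; apply: (mulIr (divD _ xij)); rewrite -!phif; exact: fdd'.
Qed.

End MatrixAlgebra.

(** * A small left ideal when u^a = 1 *)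

Lemma sum_shift_periodic (V : nmodType) (h : nat -> V) n i :
  (forall k, h (k + n)%N = h k) -> \sum_(j < n) h (i + j)%N = \sum_(j < n) h j.
Proof.
case: n => [|n] per; first by rewrite !big_ord0.
elim: i => [|i IHi]; first by apply: eq_bigr.
rewrite -IHi big_ord_recr [RHS]big_ord_recl /= addSnnS per addn0 addrC.
by congr (_ + _); apply: eq_bigr => j _; rewrite addSnnS.
Qed.

Section SplitAlgebra.
Variables (F : fieldType) (E : splittingFieldType F) (s : gal_of {:E}).
Variables (hs : cyclic_gen s) (g : F).
Local Notation A := (cyclic_algebra hs g).
Local Notation a := (\dim {:E}).

Lemma dim_cyclic_algebra : \dim {:A} = (a * a)%N.
Proof. by rewrite !dimvf /dim /= card_ord dimvf. Qed.

(** Here [f c] is c (1 + u + ... + u^(a-1)). As u^a = 1, multiplying by u permutes the summands of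
    [f 1], so c u^i sends [f 1] to [f c] and the left ideal of [f 1] is the image of [f]. *)
Lemma cyclic_split_ideal : g = 1 ->
  exists2 x : A, x != 0
    & exists2 U : {vspace A}, (\dim U <= a)%N & forall y, y * x \in U.
Proof.
move=> g1; pose f (c : E) : A := [ffun => c].
have linf : linear f by move=> k c d; apply/ffunP => i; rewrite !ffunE.
pose f' : {linear _ -> _} := HB.pack f (GRing.isLinear.Build _ _ _ _ f linf).
have a_gt0 : (0 < a)%N := adim_gt0 _.
exists (f 1).
  by apply/eqP => /ffunP/(_ (Ordinal a_gt0)) /eqP; rewrite !ffunE oner_eq0.
exists (limg (linfun f')).
  by rewrite -[leqRHS](limg_ker_dim (linfun f') fullv) leq_addl.
have sum_mono c : f c = \sum_(j < a) cyc_mono hs g c j.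
  by rewrite [LHS]cyc_sum; apply: eq_bigr => j _; rewrite ffunE.
have monoM c i : cyc_mono hs g c i * f 1 = f c.
  rewrite [f 1]sum_mono mulr_sumr [RHS]sum_mono.
  rewrite -(sum_shift_periodic i) => [|k].
    by apply: eq_bigr => j _; rewrite [LHS]cyc_mul_mono rmorph1 mulr1.
  by apply/ffunP => l; rewrite !ffunE modnDr g1 !expr1n.
move=> y; rewrite [y]cyc_sum mulr_suml rpred_sum // => i _.
by rewrite monoM -[f _](lfunE f') memv_img ?memvf.
Qed.

End SplitAlgebra.

(** * Left ideals under extension of scalars *)

Section BaseChangeIdeal.
Variables (F K : fieldType) (f : {rmorphism F -> K}) (A : falgType F).
Local Notation AK := (base_change f A).

Lemma dim_base_change : \dim {:AK} = \dim {:A}.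
Proof. by rewrite dimvf /dim /= mul1n. Qed.

Lemma bc_in_neq0 (x : A) : x != 0 -> (bc_in f x : AK) != 0.
Proof.
apply: contraNneq => /rowP x0; rewrite (coord_vbasis (memvf x)) big1 // => i _.
by have /eqP := x0 i; rewrite !mxE fmorph_eq0 => /eqP ->; rewrite scale0r.
Qed.

(** Elements of the extended algebra are K-combinations of basis vectors e_i, and each e_i x lies in
    [U]; hence the K-span of the image of a basis of [U] suffices. *)
Lemma base_change_ideal (x : A) (U : {vspace A}) : (forall y, y * x \in U) ->
  exists2 W : {vspace AK}, (\dim W <= \dim U)%N
    & forall y : AK, y * (bc_in f x : AK) \in W.
Proof.
move=> xU; exists <<[seq (bc_in f v : AK) | v <- vbasis U]>>%VS.
  by rewrite (leq_trans (dim_span _)) // size_map size_tuple.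
move=> y; rewrite [_ * _]bc_mul_suml_basis rpred_sum // => i _.
rewrite memvZ // -bc_inM (coord_vbasis (xU _)) bc_in_sum rpred_sum // => j _.
rewrite bc_inZ memvZ // memv_span //; apply: map_f.
by rewrite mem_nth ?size_tuple.
Qed.

End BaseChangeIdeal.

(** * Consequences of local index 2 *)

Lemma real_unity_root (C : numClosedFieldType) (x : C) n :
  (0 < n)%N -> x ^+ n = 1 -> x \is Num.real -> x = 1 \/ x = -1.
Proof.
move=> n0 xn xR; have /eqP : x ^+ 2 = 1.
  by rewrite -real_normK // (norm_unity_root n0 xn) expr1n.
by rewrite sqrf_eq1 => /orP[] /eqP ->; [left | right].
Qed.

Lemma completion_closed (R : realType) (F : fieldType)
    (v : {rmorphism F -> R[i]}) (x : F) : v x \isn't Num.real ->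
  forall p : {poly completion v}, size p != 1 -> exists y, root p y.
Proof.
move=> xR p; rewrite -(size_map_poly (\val : completion v -> R[i])).
move=> /closed_rootP[y /rootP py].
exists (Sub y (in_completion_full xR y) : completion v); apply/rootP/val_inj.
by rewrite -[LHS]horner_map /= py.
Qed.

Section LocalIndexTwo.
Variables (R : realType) (F : fieldType) (E : splittingFieldType F).
Variables (s : gal_of {:E}) (hs : cyclic_gen s) (g : F).
Variable v : {rmorphism F -> R[i]}.
Local Notation a := (\dim {:E}).

Hypothesis index2 : local_index (cyclic_algebra hs g) v 2.

Lemma local_index2_real x : v x \is Num.real.
Proof.
case: index2 => r [D [phi [divD _ _ _ dimD]]]; apply/negPn/negP => xR.
by have := closed_division_dim (completion_closed xR) divD; rewrite dimD.
Qed.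

(** Comparing dimensions over the completion gives a^2 = 4 (r+1)^2. *)
Lemma local_index2_degree : exists r, a = r.+1.*2.
Proof.
case: index2 => r [D [phi [_ _ phi_bij phi_alg dimD]]]; exists r.
apply/eqP; have := dim_matrix_algebra phi_alg phi_bij.
rewrite dim_base_change dim_cyclic_algebra dimD -expnMn mulnn muln2.
by move/eqP; rewrite eqn_sqr.
Qed.

(** For g = 1 the ideal of dimension at most a survives the base change, so 4 (r+1) <= a, against a
    = 2 (r+1). *)
Lemma local_index2_neq1 : g != 1.
Proof.
case: index2 => r [D [phi [divD _ phi_bij phi_alg dimD]]].
apply/eqP => /(cyclic_split_ideal hs)[x x0 [U dimU xU]].
have [W dimW xW] := base_change_ideal (completion_in v) xU.
have x'0 := bc_in_neq0 (completion_in v) x0.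
have := dim_left_ideal_ge phi_alg phi_bij divD x'0 xW.
move=> /leq_trans/(_ dimW)/leq_trans/(_ dimU).
have /eqP := dim_matrix_algebra phi_alg phi_bij.
rewrite dim_base_change dim_cyclic_algebra dimD -expnMn mulnn eqn_sqr.
move=> /eqP ->.
by rewrite leq_pmul2l.
Qed.

End LocalIndexTwo.

(** For n <= 2 the root of unity is 1 or -1, so the extension is trivial. *)
Lemma adjoin_unity_root_gt2 (F : fieldType) (E : splittingFieldType F) n
    (z : E) :
  n.-primitive_root z -> <<1; z>>%VS = {:E}%VS -> (1 < \dim {:E})%N ->
  (2 < n)%N.
Proof.
move=> prz hE; apply: contraTltn => n2; rewrite -leqNgt -hE.
suff /Fadjoin_idP -> : z \in 1%VS by rewrite dimv1.
have /eqP : z ^+ 2 = 1.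
  have := prim_expr_order prz; have := prim_order_gt0 prz.
  by case: n {prz} n2 => [|[|[]]] //= _ _; rewrite ?expr1 => ->;
    rewrite ?expr1n.
by rewrite sqrf_eq1 => /orP[] /eqP ->; rewrite ?memvN mem1v.
Qed.

Lemma local_index2_only_if (R : realType) (F : fieldExtType rat)
    (E : splittingFieldType F)
    (iota : {rmorphism E -> R[i]}) (n : nat) (z : E) (c : int)
    (s : gal_of {:E}) (g : F) (v : {rmorphism F -> R[i]})
    (habel : abelian_number_field (fun x : F => iota x%:A))
    (hz : n.-primitive_root z)
    (hE : <<1; z>>%VS = {:E}%VS) (hs : cyclic_gen s)
    (hg : g%:A = z ^ c) :
  local_index (cyclic_algebra hs g) v 2 ->
  [/\ forall x : F, iota x%:A \is Num.real, (2 < n)%N & z ^ c = -1].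
Proof.
move=> idx2; have [N [w [prw iotaE]]] := habel.
have vR := local_index2_real idx2; have [r aE] := local_index2_degree idx2.
have gn : g ^+ n = 1.
  apply: (fmorph_inj (in_alg E)); rewrite rmorphXn /= scale1r hg.
  by rewrite exprnP exprzAC -exprnP (prim_expr_order hz) exp1rz.
have n0 := prim_order_gt0 hz.
split.
- move=> x.
  exact: (@abelian_conjugate_real _ _ (iota \o in_alg E) v N w prw iotaE x
    (vR x)).
- by apply: (adjoin_unity_root_gt2 hz hE); rewrite aE.
(* [v g] is a real root of unity, hence 1 or -1, and the injectivity of [v] carries this back to
   [g]. *)
rewrite -hg; have vgn : v g ^+ n = 1 by rewrite -rmorphXn gn rmorph1.
case: (real_unity_root n0 vgn (vR g)) => [|vg].
  rewrite -(rmorph1 v) => /fmorph_inj /eqP.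
  by rewrite (negPf (local_index2_neq1 idx2)).
suff -> : g = -1 by rewrite scaleN1r.
by apply: (fmorph_inj v); rewrite rmorphN1.
Qed.

(** * Hamilton quaternions over a field *)

Definition quaternion (K : fieldType) : Type := (K^o * K^o * (K^o * K^o))%type.

Section Quaternion.
Variable K : fieldType.
Local Notation H := (quaternion K).

HB.instance Definition _ := Vector.copy H (K^o * K^o * (K^o * K^o))%type.

(** The element a + b i + c j + d k, with i^2 = j^2 = -1 and i j = k = - j i. *)
Definition quat (a b c d : K) : H := ((a, b), (c, d)).

Definition quat_mul (x y : H) : H :=
  let: ((a, b), (c, d)) := x in let: ((a', b'), (c', d')) := y in
  quat (a * a' - b * b' - c * c' - d * d') (a * b' + b * a' + c * d' - d * c')
       (a * c' - b * d' + c * a' + d * b') (a * d' + b * c' - c * b' + d * a').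

Lemma quatP (x : H) : exists a b c d, x = quat a b c d.
Proof. by case: x => -[a b] [c d]; exists a, b, c, d. Qed.

Lemma quatD (a b c d a' b' c' d' : K) :
  quat a b c d + quat a' b' c' d' = quat (a + a') (b + b') (c + c') (d + d').
Proof. by []. Qed.

Lemma quatZ (k a b c d : K) :
  k *: quat a b c d = quat (k * a) (k * b) (k * c) (k * d).
Proof. by []. Qed.

Lemma quatM (a b c d a' b' c' d' : K) :
  quat_mul (quat a b c d) (quat a' b' c' d') =
  quat (a * a' - b * b' - c * c' - d * d') (a * b' + b * a' + c * d' - d * c')
       (a * c' - b * d' + c * a' + d * b') (a * d' + b * c' - c * b' + d * a').
Proof. by []. Qed.

Lemma quat_inj a b c d a' b' c' d' : quat a b c d = quat a' b' c' d' ->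
  [/\ a = a', b = b', c = c' & d = d'].
Proof. by case. Qed.

Lemma quat_mulA : associative quat_mul.
Proof.
move=> x y z; have [a [b [c [d ->]]]] := quatP x.
have [a' [b' [c' [d' ->]]]] := quatP y; have [? [? [? [? ->]]]] := quatP z.
by rewrite !quatM; congr quat; ring.
Qed.

Lemma quat_mul1l : left_id (quat 1 0 0 0) quat_mul.
Proof.
move=> x; have [a [b [c [d ->]]]] := quatP x.
by rewrite quatM; congr quat; ring.
Qed.

Lemma quat_mul1r : right_id (quat 1 0 0 0) quat_mul.
Proof.
move=> x; have [a [b [c [d ->]]]] := quatP x.
by rewrite quatM; congr quat; ring.
Qed.

Lemma quat_mulDl : left_distributive quat_mul +%R.
Proof.
move=> x y z; have [a [b [c [d ->]]]] := quatP x.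
have [a' [b' [c' [d' ->]]]] := quatP y; have [? [? [? [? ->]]]] := quatP z.
by rewrite quatD !quatM quatD; congr quat; ring.
Qed.

Lemma quat_mulDr : right_distributive quat_mul +%R.
Proof.
move=> x y z; have [a [b [c [d ->]]]] := quatP x.
have [a' [b' [c' [d' ->]]]] := quatP y; have [? [? [? [? ->]]]] := quatP z.
by rewrite quatD !quatM quatD; congr quat; ring.
Qed.

Lemma quat_1neq0 : quat 1 0 0 0 != 0.
Proof. by apply/eqP => /quat_inj[/eqP]; rewrite oner_eq0. Qed.

Lemma quat_scalerAl k x y : k *: quat_mul x y = quat_mul (k *: x) y.
Proof.
have [a [b [c [d ->]]]] := quatP x; have [a' [b' [c' [d' ->]]]] := quatP y.
by rewrite quatM quatZ (quatZ k a b c d) quatM; congr quat; ring.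
Qed.

Lemma quat_scalerAr k x y : k *: quat_mul x y = quat_mul x (k *: y).
Proof.
have [a [b [c [d ->]]]] := quatP x; have [a' [b' [c' [d' ->]]]] := quatP y.
by rewrite quatM quatZ (quatZ k a' b' c' d') quatM; congr quat; ring.
Qed.

HB.instance Definition _ := GRing.Zmodule_isNzRing.Build H
  quat_mulA quat_mul1l quat_mul1r quat_mulDl quat_mulDr quat_1neq0.
HB.instance Definition _ := GRing.Lmodule_isLalgebra.Build K H quat_scalerAl.
HB.instance Definition _ := GRing.Lalgebra_isAlgebra.Build K H quat_scalerAr.
HB.instance Definition _ := Algebra_isFalgebra.Build K H.

Lemma dim_quaternion : \dim {:H} = 4%N.
Proof. by rewrite dimvf. Qed.

Lemma quat_scalar (k : K) : k%:A = quat k 0 0 0 :> H.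
Proof. by apply: etrans (quatZ k 1 0 0 0) _; rewrite mulr1 mulr0. Qed.

Hypothesis sum4_sqr_eq0 : forall a b c d : K,
  a ^+ 2 + b ^+ 2 + c ^+ 2 + d ^+ 2 = 0 -> [/\ a = 0, b = 0, c = 0 & d = 0].

(** The norm form is anisotropic, so the conjugate divided by the norm is an inverse. *)
Lemma quat_division (x : H) : x != 0 -> x \is a GRing.unit.
Proof.
have [a [b [c [d ->]]]] := quatP x => x0.
pose n := a ^+ 2 + b ^+ 2 + c ^+ 2 + d ^+ 2.
have n0 : n != 0 by apply: contra_neqN x0 => /eqP/sum4_sqr_eq0[-> -> -> ->].
apply/unitrP; exists (quat (a / n) (- b / n) (- c / n) (- d / n)).
by rewrite /n in n0 *; split; rewrite [LHS]quatM; congr quat; field.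
Qed.

(** Commuting with i gives c = -c and d = -d, commuting with j gives b = -b; and 2 is not 0, since
    1^2 + 1^2 is not. *)
Lemma quat_center (x : H) :
  (forall y, x * y = y * x) -> exists k : K, x = k%:A.
Proof.
have [a [b [c [d ->]]]] := quatP x => cx.
have n2 : 2 != 0 :> K.
  apply/eqP => n2; have [] := @sum4_sqr_eq0 1 1 0 0.
    by rewrite expr1n expr0n !addr0.
  by move=> /eqP; rewrite oner_eq0.
have opp0 (y : K) : y = - y -> y = 0.
  move=> /eqP; rewrite -subr_eq0 opprK -mulr2n -mulr_natl mulf_eq0.
  by rewrite (negPf n2) => /eqP.
have := cx (quat 0 1 0 0); rewrite [LHS]quatM [RHS]quatM.
case/quat_inj => _ _ e1 e2.
have := cx (quat 0 0 1 0); rewrite [LHS]quatM [RHS]quatM.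
case/quat_inj => _ _ _ e3.
exists a; rewrite quat_scalar; congr quat; apply: opp0.
- by apply: etrans (etrans _ e3) _; ring.
- by apply: etrans (etrans _ (esym e2)) _; ring.
- by apply: etrans (etrans _ e1) _; ring.
Qed.

End Quaternion.

(** * Complex conjugation as a power of the generator *)

Lemma cyclic_gen_order (F : fieldType) (E : splittingFieldType F)
  (s : gal_of {:E}) : cyclic_gen s -> \dim {:E} = #[s]%g.
Proof.
case/andP => galE /eqP genE.
by rewrite /order -genE -(galois_dim galE) dimv1 divn1.
Qed.

Section ConjugationIsPower.
Variables (C : numClosedFieldType) (F : fieldType) (E : splittingFieldType F).
Variables (iota : {rmorphism E -> C}) (n : nat) (z : E) (s : gal_of {:E}).
Hypotheses (prz : n.-primitive_root z) (hE : <<1; z>>%VS = {:E}%VS).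
Hypotheses (hs : cyclic_gen s) (n2 : (2 < n)%N).
Hypothesis FR : forall x : F, iota x%:A \is Num.real.

(** The conjugate z^(n-1) of z lies in E and is a root of the minimal polynomial of z, whose
    coefficients are real. Normality yields an automorphism sending z there, and z generates E. *)
Lemma gal_conjugation : exists2 t : gal_of {:E}, t \in 'Gal({:E} / 1)%g
  & forall x, iota (t x) = ((iota x)^*)%R.
Proof.
have n0 := prim_order_gt0 prz; have /andP[galE _] := hs.
pose z' := z ^+ n.-1.
have z'E : iota z' = ((iota z)^*)%R.
  rewrite rmorphXn (@conj_unity_root _ n) //.
  by rewrite -rmorphXn prim_expr_order ?rmorph1.
have conjE (p : {poly E}) : p \is a polyOver 1%VS ->
    iota p.[z'] = ((iota p.[z])^*)%R.
  move=> /polyOverP p1; rewrite -!horner_map z'E; congr _.[_].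
  apply/polyP => i; rewrite !coef_map /=.
  by have /vlineP[k ->] := p1 i; rewrite [RHS]conj_Creal.
have rz' : root (minPoly 1 z) z'.
  rewrite /root -(fmorph_eq0 iota) conjE ?minPolyOver //.
  by rewrite (rootP (root_minPoly _ _)) !rmorph0.
have /and3P[s1E _ normE] := galE.
have [t tG tz] := normalField_root_minPoly s1E normE (memvf z) rz'.
exists t => // x; have : x \in <<1; z>>%VS by rewrite hE memvf.
case/Fadjoin_polyP => p p1 ->; rewrite -conjE //; congr (iota _).
by rewrite -horner_map /= tz (fixedPoly_gal s1E tG p1).
Qed.

Lemma conjugation_is_power : exists2 m, (0 < m)%N & \dim {:E} = m.*2 /\
  forall x, iota ((s ^+ m)%g x) = ((iota x)^*)%R.
Proof.
have [t tG tE] := gal_conjugation; have /andP[_ /eqP genE] := hs.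
have dimE := cyclic_gen_order hs.
have /cyclePmin[m lt_m tm] : t \in <[s]>%g by rewrite -genE.
(* If m were 0, z would equal its conjugate z^(n-1), so z^2 = 1, against n > 2. *)
have m0 : (0 < m)%N.
  rewrite lt0n; apply/eqP => m0.
  have n0 := prim_order_gt0 prz.
  have := tE z; rewrite tm m0 expg0 gal_id.
  rewrite (@conj_unity_root _ n) //; last first.
    by rewrite -rmorphXn prim_expr_order ?rmorph1.
  rewrite -rmorphXn => /fmorph_inj /(congr1 ( *%R z)).
  rewrite -exprS prednK // prim_expr_order // -expr2 => /eqP.
  by rewrite -(prim_order_dvd prz) gtnNdvd.
exists m => //; split; last by move=> x; rewrite -tm.
(* Conjugation is an involution, so the order a divides 2 m; with 0 < m < a the quotient can only be
   1. *)
have : (#[s]%g %| m.*2)%N.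
  rewrite order_dvdn; apply/eqP/eqP/gal_eqP => x _.
  apply: (fmorph_inj iota); rewrite -addnn expgD galM ?memvf //.
  by rewrite -tm gal_id !tE conjCK.
case/dvdnP => -[|[|k]]; first by move=> /eqP; rewrite mul0n double_eq0 gtn_eqF.
  by rewrite mul1n dimE => ->.
rewrite -addnn => e; have : (m + m < #[s]%g + #[s]%g)%N.
  by rewrite -addSn leq_add // ltnW.
by rewrite e !mulSn addnA ltnNge leq_addr.
Qed.

End ConjugationIsPower.

(** * Extending a morphism to the base change *)

Section BaseChangeHom.
Variables (F K : fieldType) (f : {rmorphism F -> K}) (A : falgType F).
Variables (B : nzRingType) (sc : {rmorphism K -> B}) (rho : {rmorphism A -> B}).
Hypothesis sc_central : forall k b, sc k * b = b * sc k.
Hypothesis rhoZ : forall c x, rho (c *: x) = sc (f c) * rho x.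
Local Notation AK := (base_change f A).

(** The map sending v tensor k to [sc k * rho v], written on the basis of [A]; it is multiplicative
    because the image of [sc] is central. *)
Definition bc_hom (y : AK) : B := \sum_i sc (y 0 i) * rho (vbasis {:A})`_i.

Lemma bc_hom_zmod : zmod_morphism bc_hom.
Proof.
move=> y z; rewrite /bc_hom -sumrB; apply: eq_bigr => i _.
by rewrite !mxE rmorphB mulrBl.
Qed.

HB.instance Definition _ :=
  GRing.isZmodMorphism.Build AK B bc_hom bc_hom_zmod.

Lemma bc_homZ k y : bc_hom (k *: y) = sc k * bc_hom y.
Proof.
rewrite /bc_hom mulr_sumr; apply: eq_bigr => i _.
by rewrite mxE rmorphM mulrA.
Qed.

Lemma bc_hom_in v : bc_hom (bc_in f v) = rho v.
Proof.
rewrite [in RHS](coord_vbasis (memvf v)) rmorph_sum; apply: eq_bigr => i _.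
by rewrite mxE rhoZ.
Qed.

Lemma bc_hom_monoid : monoid_morphism bc_hom.
Proof.
split=> [|y z]; first by rewrite bc_hom_in rmorph1.
rewrite [y * z]/(bc_mul y z) raddf_sum mulr_suml; apply: eq_bigr => i _.
rewrite raddf_sum mulr_sumr; apply: eq_bigr => j _.
rewrite /= bc_homZ bc_hom_in !rmorphM -!mulrA; congr (_ * _).
by rewrite !mulrA sc_central.
Qed.

HB.instance Definition _ :=
  GRing.isMonoidMorphism.Build AK B bc_hom bc_hom_monoid.

Definition bc_rmorphism : {rmorphism AK -> B} := bc_hom.

End BaseChangeHom.

(** * The decomposition H = C + C j *)

Section QuaternionOfComplex.
Variables (R : rcfType) (K : fieldType) (kR : {rmorphism R -> K}).
Local Notation H := (quaternion K).

Definition quat_complex (x : R[i]) : H :=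
  quat (kR (complex.Re x)) (kR (complex.Im x)) 0 0.

Lemma quat_complex_zmod : zmod_morphism quat_complex.
Proof.
case=> [a b] [c d]; rewrite /quat_complex /= !rmorphB.
by apply: etrans (esym (quatD _ _ _ _ _ _ _ _)); rewrite ?rmorphN ?oppr0 ?addr0.
Qed.

Lemma quat_complex_monoid : monoid_morphism quat_complex.
Proof.
split=> [|[a b] [c d]]; first by rewrite /quat_complex /= rmorph1 rmorph0.
rewrite /quat_complex /= [RHS]quatM !rmorphB !rmorphD !rmorphM.
by congr quat; ring.
Qed.

HB.instance Definition _ :=
  GRing.isZmodMorphism.Build R[i] H quat_complex quat_complex_zmod.
HB.instance Definition _ :=
  GRing.isMonoidMorphism.Build R[i] H quat_complex quat_complex_monoid.

Definition quat_j : H := quat 0 0 1 0.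

Lemma quat_j_sqr : quat_j ^+ 2 = -1.
Proof.
rewrite expr2 [LHS]quatM; apply: etrans (_ : quat (-1) 0 0 0 = _); last first.
  by rewrite -[RHS]scaleN1r [RHS]quat_scalar.
by congr quat; ring.
Qed.

Lemma quat_jC x : quat_j * quat_complex x = quat_complex (x^*)%R * quat_j.
Proof.
case: x => a b; rewrite [LHS]quatM [RHS]quatM /= rmorphN; congr quat; ring.
Qed.

(** The sum C + C j is direct, as 1, i, j and i j = k are independent. *)
Lemma quat_j_eq0 x y :
  quat_complex x + quat_complex y * quat_j = 0 -> x = 0 /\ y = 0.
Proof.
case: x y => [a b] [c d].
rewrite {2}/quat_complex [_ * _]quatM quatD /= => /quat_inj[].
rewrite !(mulr0, mul0r, mulr1, subr0, addr0, add0r).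
by do 4![move=> /eqP; rewrite fmorph_eq0 => /eqP ->].
Qed.

End QuaternionOfComplex.

(** Dedekind independence: a row vector killed by the matrix is a linear relation among the powers
    of [s] below its order, first on a basis and then on all of E. *)
Lemma gal_powers_unitmx (F : fieldType) (E : splittingFieldType F)
    (s : gal_of {:E}) : cyclic_gen s ->
  \matrix_(p < \dim {:E}, k < \dim {:E}) (s ^+ p)%g (vbasis {:E})`_k \in unitmx.
Proof.
move=> /cyclic_gen_order dimE.
rewrite -row_free_unit; apply: inj_row_free => v /rowP vM0.
have v0 x : \sum_p v 0 p * (s ^+ p)%g x = 0.
  rewrite (coord_vbasis (memvf x)).
  transitivity (\sum_k coord (vbasis {:E}) k x *:
      \sum_p v 0 p * (s ^+ p)%g (vbasis {:E})`_k).
    under [RHS]eq_bigr do rewrite scaler_sumr.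
    rewrite exchange_big; apply: eq_bigr => p _.
    rewrite rmorph_sum mulr_sumr; apply: eq_bigr => k _.
    by rewrite /= linearZ scalerAr.
  rewrite big1 // => k _.
  suff -> : \sum_p v 0 p * (s ^+ p)%g (vbasis {:E})`_k = 0.
    exact: scaler0.
  have := vM0 k; rewrite !mxE; apply: etrans.
  by apply: eq_bigr => p _; rewrite mxE.
(* The coefficients are reindexed by automorphisms, distinct exponents below the order giving
   distinct ones. *)
pose c_ (t : gal_of {:E}) :=
  \sum_(p < \dim {:E}) if (s ^+ p)%g == t then v 0 p else 0.
apply/rowP => p; rewrite mxE.
have -> : v 0 p = c_ (s ^+ p)%g.
  rewrite /c_ (bigD1 p) //= eqxx big1 ?addr0 // => p' /negPf pp'.
  by rewrite eq_expg_mod_order -dimE !modn_small // (inj_eq val_inj) pp'.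
apply: (@gal_independent _ _ _ xpredT) => // x _.
rewrite -[RHS](v0 x); under eq_bigr do rewrite mulr_suml.
rewrite exchange_big; apply: eq_bigr => p' _.
rewrite (bigD1 (s ^+ p')%g) //= eqxx big1 ?addr0 // => t /negPf.
by rewrite eq_sym => ->; rewrite mul0r.
Qed.

(** * The representation of the cyclic algebra by quaternion matrices *)

Section CyclicQuaternionMatrices.
Variables (R : rcfType) (F : fieldType) (E : splittingFieldType F).
Variables (s : gal_of {:E}) (hs : cyclic_gen s).
Variables (iota : {rmorphism E -> R[i]}) (r : nat).
Local Notation m := r.+1.
Hypothesis dimE : \dim {:E} = m.*2.
Hypothesis conjE : forall x, iota ((s ^+ m)%g x) = ((iota x)^*)%R.
(** [K] stands for a real completion: [kval] embeds it in C with real values, [kR] inverts [kval] on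
    these, and [f] followed by [kval] is [iota] on F. *)
Variables (K : fieldType) (kR : {rmorphism R -> K}) (f : {rmorphism F -> K}).
Variable kval : {rmorphism K -> R[i]}.
Local Notation H := (quaternion K).
Local Notation q := (quat_complex kR).
Local Notation j := (quat_j K).
Hypothesis valE : forall k, q (kval k) = k%:A.
Hypothesis val_real : forall k, ((kval k)^*)%R = kval k.
Hypothesis valf : forall x, kval (f x) = iota x%:A.
Local Notation A := (cyclic_algebra hs (-1)).

Lemma quat_j_conj k y :
  j ^+ k * q (iota y) = q (iota ((s ^+ (k * m))%g y)) * j ^+ k.
Proof.
elim: k => [|k IHk]; first by rewrite mul1r mulr1 gal_id.
rewrite exprS -mulrA IHk !mulrA quat_jC -conjE; congr (q (iota _) * _ * _).
by rewrite mulSn cyc_gal_expD.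
Qed.

(* The image of c u^t: since u is the shift with corner j, the p-th row of u^t
   is j^((p + t) / m) in column (p + t) mod m. *)
Definition quat_mono (c : E) (t : nat) : 'M[H]_m :=
  \matrix_(p, l) if l == ((p + t) %% m)%N :> nat
    then q (iota ((s ^+ p)%g c)) * j ^+ ((p + t) %/ m)%N else 0.

Lemma quat_monoD t : {morph quat_mono^~ t : c d / c + d}.
Proof.
move=> c d; apply/matrixP => p l; rewrite !mxE; case: ifP => _.
  by rewrite !rmorphD mulrDl.
by rewrite addr0.
Qed.

(** Row p of the first factor meets only column (p + i) mod m. Moving its j^((p + i) / m) to the
    right past sigma^((p + i) mod m) d raises that exponent to p + i. *)
Lemma quat_monoM c i d k :
  quat_mono c i * quat_mono d k = quat_mono (c * (s ^+ i)%g d) (i + k).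
Proof.
apply/matrixP => p l; rewrite mxE.
pose u : 'I_m := Ordinal (ltn_pmod (p + i) (ltn0Sn r)).
rewrite (bigD1 u) //= big1 ?addr0 => [|u' /negPf uu']; last first.
  rewrite [X in X * _]mxE -[(_ %% _)%N]/(nat_of_ord u) (inj_eq val_inj).
  by rewrite uu' mul0r.
rewrite !mxE eqxx /= modnDml -addnA; case: ifP => _; last by rewrite mulr0.
rewrite -mulrA [j ^+ _ * _]mulrA quat_j_conj -cyc_gal_expD -divn_eq.
rewrite -mulrA -exprD -divnMDl // [(_ * m + _)%N]addnA -divn_eq mulrA.
rewrite -!rmorphM /=.
by rewrite addnA cyc_gal_expD (rmorphM (s ^+ p)%g).
Qed.

(** This is u^a = -1: as a = 2 m, lowering the exponent by a removes a factor j^2 = -1. *)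
Lemma quat_mono_wrap c i :
  quat_mono (c * ((-1) ^+ (i %/ \dim {:E}))%:A) (i %% \dim {:E}) =
  quat_mono c i.
Proof.
apply/matrixP => p l; rewrite !mxE.
have iE : (p + i = (i %/ m.*2).*2 * m + (p + i %% m.*2))%N.
  by rewrite {1}(divn_eq i m.*2) addnCA -doubleMl -doubleMr.
rewrite dimE [in RHS]iE modnMDl divnMDl //; case: ifP => // _.
rewrite rmorphM /= cyc_gal_alg !rmorphM /= -valf !rmorphXn !rmorphN1 -mulrA.
by rewrite exprD -(mul2n (i %/ m.*2)) exprM quat_j_sqr.
Qed.

Definition cyclic_to_mx (x : A) : 'M[H]_m := \sum_t quat_mono (x t) t.

Lemma cyclic_to_mx_zmod : zmod_morphism cyclic_to_mx.
Proof.
move=> x y; rewrite /cyclic_to_mx -sumrB; apply: eq_bigr => t _.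
apply/eqP; rewrite eq_sym subr_eq -quat_monoD ffunE; apply/eqP.
by rewrite [in RHS]ffunE subrK.
Qed.

HB.instance Definition _ :=
  GRing.isZmodMorphism.Build A 'M[H]_m cyclic_to_mx cyclic_to_mx_zmod.

Lemma cyclic_to_mx_mono c i :
  cyclic_to_mx (cyc_mono hs (-1) c i) = quat_mono c i.
Proof.
have a_gt0 : (0 < \dim {:E})%N := adim_gt0 _.
have quat_mono0 k : quat_mono 0 k = 0.
  by apply: (addrI (quat_mono 0 k)); rewrite -quat_monoD !addr0.
pose u : 'I_(\dim {:E}) := Ordinal (ltn_pmod i a_gt0).
rewrite /cyclic_to_mx (bigD1 u) //= big1 ?addr0 => [|k /negPf ku].
  by rewrite ffunE eqxx quat_mono_wrap.
by rewrite ffunE -[(_ %% _)%N]/(nat_of_ord u) (inj_eq val_inj) ku quat_mono0.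
Qed.

Lemma cyclic_to_mx_monoid : monoid_morphism cyclic_to_mx.
Proof.
split=> [|x y].
  rewrite [1]/(cyc_mono hs (-1) 1 0) cyclic_to_mx_mono; apply/matrixP => p l.
  rewrite !mxE addn0 modn_small // divn_small // !rmorph1 mulr1 eq_sym.
  by rewrite (inj_eq val_inj); case: eqP.
rewrite [x]cyc_sum [y]cyc_sum mulr_suml !raddf_sum mulr_suml.
apply: eq_bigr => i _; rewrite mulr_sumr raddf_sum mulr_sumr.
apply: eq_bigr => k _; rewrite [cyc_mono _ _ _ _ * _]cyc_mul_mono /=.
by rewrite !cyclic_to_mx_mono quat_monoM.
Qed.

HB.instance Definition _ :=
  GRing.isMonoidMorphism.Build A 'M[H]_m cyclic_to_mx cyclic_to_mx_monoid.

Definition cyclic_rmorphism : {rmorphism A -> 'M[H]_m} := cyclic_to_mx.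

Local Notation sc := (scalar_mx \o in_alg H : {rmorphism K -> 'M[H]_m}).

Lemma scalar_central k (b : 'M[H]_m) : sc k * b = b * sc k.
Proof.
rewrite /= -mulmxE mul_scalar_mx -diag_const_mx mul_mx_diag.
by apply/matrixP => p l; rewrite !mxE mulr_algl mulr_algr.
Qed.

Lemma cyclic_rmorphismZ c x :
  cyclic_rmorphism (c *: x) = sc (f c) * cyclic_rmorphism x.
Proof.
rewrite /= /cyclic_to_mx mulr_sumr; apply: eq_bigr => t _.
rewrite ffunE /= -mulmxE mul_scalar_mx; apply/matrixP => p l; rewrite !mxE.
case: ifP => _; last by rewrite mulr0.
by rewrite -valE valf mulrA -!rmorphM -(cyc_gal_alg s p) -rmorphM mulr_algl.
Qed.

Lemma two_lifts (t t1 : nat) : (t < m.*2)%N -> (t %% m)%N = t1 ->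
  t = t1 \/ t = (m + t1)%N.
Proof.
move=> ta <-; rewrite {1 3}(divn_eq t m).
have : (t %/ m < 2)%N by rewrite ltn_divLR // mul2n.
by case: (t %/ m)%N => [|[|]] // _; [left | right; rewrite mul1n].
Qed.

Lemma quat_j_unit : j \is a GRing.unit.
Proof.
by apply/unitrP; exists (- j); rewrite mulNr mulrN -expr2 quat_j_sqr opprK.
Qed.

Section Injectivity.
Variable y : base_change f A.
Local Notation e := (vbasis {:A}).
Local Notation b := (vbasis {:E}).

(* The u^t-coefficient of y, mapped to C through iota o s^p. *)
Definition bc_conjugate (t : 'I_(\dim {:E})) (p : nat) : R[i] :=
  \sum_i kval (y 0 i) * iota ((s ^+ p)%g ((e`_i : A) t)).

Lemma bc_cyclic_entry (p l : 'I_m) : bc_hom sc cyclic_rmorphism y p l =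
  \sum_(t < \dim {:E}) (if l == ((p + t) %% m)%N :> nat
           then q (bc_conjugate t p) * j ^+ ((p + t) %/ m)%N else 0).
Proof.
rewrite /bc_hom summxE.
transitivity (\sum_i \sum_(t < \dim {:E})
    (y 0 i)%:A * quat_mono ((e`_i : A) t) t p l).
  apply: eq_bigr => i _; rewrite /= -mulmxE mul_scalar_mx mxE /cyclic_to_mx.
  by rewrite summxE mulr_sumr.
rewrite exchange_big; apply: eq_bigr => t _.
under eq_bigr do rewrite mxE.
case: ifP => _; last by rewrite big1 // => i _; rewrite mulr0.
rewrite rmorph_sum mulr_suml; apply: eq_bigr => i _.
by rewrite mulrA -valE -rmorphM.
Qed.

Hypothesis y0 : bc_hom sc cyclic_rmorphism y = 0.

(* Only the exponents t mod m and m + t mod m contribute to the entry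
   (p, (p + t) mod m); their powers of j are consecutive, so the two terms are
   independent. *)
Lemma bc_conjugate_eq0_lt t (p : 'I_m) : bc_conjugate t p = 0.
Proof.
have t1m : (t %% m < m)%N by rewrite ltn_mod.
have T1a : (t %% m < \dim {:E})%N.
  by apply: leq_trans t1m _; rewrite dimE -addnn leq_addr.
have T2a : (m + t %% m < \dim {:E})%N 
  by apply: (@leq_trans (m + m)); [rewrite ltn_add2l | rewrite dimE addnn].
pose T1 := Ordinal T1a; pose T2 := Ordinal T2a.
have T21 : T2 != T1 by rewrite -val_eqE /= -[X in _ != X]add0n eqn_add2r.
pose l : 'I_m := Ordinal (ltn_pmod (p + t %% m) (ltn0Sn r)).
have := bc_cyclic_entry p l; rewrite y0 mxE (bigD1 T1) //= eqxx.
rewrite (bigD1 T2) //= addnCA modnDl eqxx big1 ?addr0 => [|t' /andP[t'1 t'2]].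
  rewrite [((m + _) %/ m)%N]divnDl // divnn /= exprD expr1 mulrA -mulrDl.
  move=> /esym/eqP.
  rewrite -[X in _ == X](mul0r (j ^+ ((p + t %% m) %/ m)%N)).
  rewrite (inj_eq (mulIr (unitrX _ quat_j_unit))) => /eqP/quat_j_eq0[C1 C2].
  have ta : (t < m.*2)%N by rewrite -dimE.
  have [tE|tE] := two_lifts ta erefl.
    by have -> : t = T1 by exact: val_inj.
  by have -> : t = T2 by exact: val_inj.
case: eqP => // /eqP; rewrite eqn_modDl modn_mod => /eqP tt'.
have t'a : (t' < m.*2)%N by rewrite -dimE.
have [t'E|t'E] := two_lifts t'a (esym tt').
  by case/eqP: t'1; apply: val_inj.
by case/eqP: t'2; apply: val_inj.
Qed.

(** As sigma^m is conjugation and the coordinates of y are real, the value at m + p is the complex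
    conjugate of the value at p. *)
Lemma bc_conjugate_eq0 t p : (p < \dim {:E})%N -> bc_conjugate t p = 0.
Proof.
rewrite dimE => pa; have pm : (p %% m < m)%N by rewrite ltn_mod.
have C0 : bc_conjugate t (p %% m)%N = 0 := bc_conjugate_eq0_lt t (Ordinal pm).
have [->//|->] := two_lifts pa erefl.
rewrite -(rmorph0 Num.conj) -C0 rmorph_sum; apply: eq_bigr => i _.
by rewrite rmorphM /= val_real cyc_gal_expD conjE.
Qed.

Lemma bc_cyclic_ker : y = 0.
Proof.
pose M := \matrix_(p < \dim {:E}, k < \dim {:E}) (s ^+ p)%g b`_k.
(* The coefficient of y at b_k u^t, seen in C. Multiplying by the matrix of conjugates [M] gives the
   vanishing [bc_conjugate t p], and [M] is invertible. *)
pose Y t : 'cV_(\dim {:E}) :=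
  \col_k \sum_i kval (y 0 i) * iota (coord b k ((e`_i : A) t))%:A.
have MY t : map_mx iota M *m Y t = 0.
  apply/colP => p; rewrite !mxE; apply: etrans (bc_conjugate_eq0 t (ltn_ord p)).
  under eq_bigr do rewrite !mxE mulr_sumr.
  rewrite exchange_big; apply: eq_bigr => i _.
  rewrite {2}(coord_vbasis (memvf ((e`_i : A) t))) !rmorph_sum mulr_sumr.
  apply: eq_bigr => k _; rewrite mulrCA /= linearZ /=; congr (_ * _).
  by rewrite -[in RHS]mulr_algl rmorphM mulrC.
have Y0 t k : Y t k 0 = 0.
  have Mu : map_mx iota M \in unitmx by rewrite map_unitmx gal_powers_unitmx.
  by rewrite -[Y t](mulKmx Mu) MY mulmx0 mxE.
have decomp (x : A) :
    x = \sum_t \sum_k coord b k (x t) *: cyc_mono hs (-1) b`_k t.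
  rewrite [LHS]cyc_sum; apply: eq_bigr => t _.
  rewrite {1}(coord_vbasis (memvf (x t))) cyc_mono_sum; apply: eq_bigr => k _.
  by rewrite cyc_monoZ.
apply/rowP => i; rewrite mxE; apply: (fmorph_inj kval); rewrite rmorph0.
(* Expanding each basis vector e_i' in the b_k u^t turns the i-th coordinate of y into a combination
   of the vanishing [Y t k 0]. *)
have -> : kval (y 0 i) =
    \sum_i' kval (y 0 i') * iota (coord e i e`_i')%:A.
  rewrite (bigD1 i) //= coord_free ?(basis_free (vbasisP _)) // eqxx.
  rewrite scale1r rmorph1 mulr1 big1 ?addr0 // => i' /negPf ii'.
  by rewrite coord_free ?(basis_free (vbasisP _)) // ii' scale0r rmorph0 mulr0.
transitivity (\sum_t \sum_k Y t k 0 *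
    iota (coord e i (cyc_mono hs (-1) b`_k t))%:A).
  transitivity (\sum_i' \sum_t \sum_k kval (y 0 i') *
      iota (coord b k ((e`_i' : A) t))%:A *
      iota (coord e i (cyc_mono hs (-1) b`_k t))%:A).
    apply: eq_bigr => i' _; rewrite {1}[e`_i'](decomp e`_i').
    rewrite !linear_sum scaler_suml rmorph_sum mulr_sumr; apply: eq_bigr => t _.
    rewrite linear_sum scaler_suml rmorph_sum mulr_sumr; apply: eq_bigr => k _.
    by rewrite linearZ /= -mulrA -rmorphM -scalerA -mulr_algl.
  rewrite exchange_big; apply: eq_bigr => t _.
  rewrite exchange_big; apply: eq_bigr => k _.
  by rewrite mxE mulr_suml.
by rewrite big1 // => t _; rewrite big1 // => k _; rewrite Y0 mul0r.
Qed.

End Injectivity.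

End CyclicQuaternionMatrices.

(** * The real completion and the index of the algebra with u^a = -1 *)

Section RealCompletion.
Variables (R : realType) (F : fieldType) (v : {rmorphism F -> R[i]}).

Definition real_completion (x : R) : completion v :=
  Sub x%:C (real_in_completion v x).

Lemma real_completion_zmod : zmod_morphism real_completion.
Proof. by move=> x y; apply: val_inj; rewrite /= rmorphB. Qed.

Lemma real_completion_monoid : monoid_morphism real_completion.
Proof. by split=> [|x y]; apply: val_inj; rewrite /= ?rmorph1 ?rmorphM. Qed.

HB.instance Definition _ :=
  GRing.isZmodMorphism.Build R (completion v) real_completion
    real_completion_zmod.
HB.instance Definition _ :=
  GRing.isMonoidMorphism.Build R (completion v) real_completion
    real_completion_monoid.

Hypothesis vR : forall x, v x \is Num.real.

Lemma completion_real (k : completion v) : val k \is Num.real.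
Proof. by apply: in_completion_real vR _ (valP k). Qed.

Lemma quat_complex_completion (k : completion v) :
  quat_complex real_completion (val k) = k%:A.
Proof.
rewrite quat_scalar /quat_complex /=; have kR := completion_real k.
have -> : real_completion (complex.Re (val k)) = k.
  by apply: val_inj; rewrite /= RRe_real.
have /eqP -> : complex.Im (val k) == 0.
  by case: (val k) kR => a b; rewrite complex_real.
by rewrite rmorph0.
Qed.

Lemma completion_sum4_sqr_eq0 (a b c d : completion v) :
  a ^+ 2 + b ^+ 2 + c ^+ 2 + d ^+ 2 = 0 -> [/\ a = 0, b = 0, c = 0 & d = 0].
Proof.
have sq0 (k : completion v) : 0 <= val k ^+ 2.
  by rewrite real_exprn_even_ge0 ?completion_real.
move=> /(congr1 val); rewrite !rmorphD !rmorphXn rmorph0 /= => /eqP.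
rewrite !paddr_eq0 ?addr_ge0 ?sq0 // !sqrf_eq0 -!andbA.
by case/and4P => /eqP ? /eqP ? /eqP ? /eqP ?; split; apply: val_inj.
Qed.

End RealCompletion.

Lemma cyclic_algebraN1_local_index (R : realType) (F : fieldType)
    (E : splittingFieldType F) (iota : {rmorphism E -> R[i]})
    (v : {rmorphism F -> R[i]}) (s : gal_of {:E}) (hs : cyclic_gen s) m :
    (forall x, v x = iota x%:A) -> (forall x, v x \is Num.real) ->
    (0 < m)%N -> \dim {:E} = m.*2 ->
    (forall x, iota ((s ^+ m)%g x) = ((iota x)^*)%R) ->
  local_index (cyclic_algebra hs (-1)) v 2.
Proof.
move=> vE vR; case: m => // r _ dimE conjE.
pose K := completion v; pose H := quaternion K.
pose kval := \val : {rmorphism K -> R[i]}.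
pose f := completion_in v : {rmorphism F -> K}.
have valE (k : K) : quat_complex (real_completion v) (kval k) = k%:A.
  exact: quat_complex_completion.
have val_real k : ((kval k)^*)%R = kval k by apply/conj_Creal/completion_real.
have valf x : kval (f x) = iota x%:A by rewrite -vE.
pose phi := bc_rmorphism (@scalar_central r K)
  (cyclic_rmorphismZ (hs := hs) dimE conjE valE valf).
have phi_alg (k : K) : phi k%:A = (k%:A)%:M.
  rewrite -[phi _]/(bc_hom _ _ _) bc_homZ -[bc_hom _ _ _]/(phi 1).
  by rewrite rmorph1 mulr1.
exists r, H, phi; split=> //.
- exact: quat_division (completion_sum4_sqr_eq0 vR).
- exact: quat_center (completion_sum4_sqr_eq0 vR).
(* Injectivity suffices, since both sides have dimension (2 m)^2 = 4 m^2. *)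
- apply: (inj_matrix_algebra_bij phi_alg).
    apply: raddf_inj => y; exact: bc_cyclic_ker.
  rewrite dim_base_change dim_cyclic_algebra dimE dim_quaternion.
  by rewrite -mulnn -muln2 mulnACA.
- exact: dim_quaternion.
Qed.

(** The prime is that of the given embedding, at which F is real; injectivity of F -> E gives g =
    -1. *)
Lemma local_index2_if (R : realType) (F : fieldType)
    (E : splittingFieldType F)
    (iota : {rmorphism E -> R[i]}) (n : nat) (z : E) (c : int)
    (s : gal_of {:E}) (g : F)
    (hz : n.-primitive_root z)
    (hE : <<1; z>>%VS = {:E}%VS) (hs : cyclic_gen s)
    (hg : g%:A = z ^ c) :
  [/\ forall x : F, iota x%:A \is Num.real, (2 < n)%N & z ^ c = -1] ->
  local_index (cyclic_algebra hs g)
    (iota \o in_alg E : {rmorphism F -> R[i]}) 2.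
Proof.
case=> FR n2 zc; have -> : g = -1.
  by apply: (fmorph_inj (in_alg E)); rewrite /= hg zc scaleN1r.
have [m m0 [dimE conjE]] := conjugation_is_power hz hE hs n2 FR.
pose v := iota \o in_alg E : {rmorphism F -> R[i]}.
exact: (@cyclic_algebraN1_local_index _ _ _ iota v s hs m (fun=> erefl) FR m0
  dimE conjE).
Qed.

(* E = F(zeta_n) is embedded in R[i] by iota, which embeds F = 1%AS as well;
   z is zeta_n, s is sigma_b and g is zeta_n^c viewed in F. *)
Theorem lemma2 (R : realType) (F : fieldExtType rat) (E : splittingFieldType F)
    (iota : {rmorphism E -> R[i]}) (n : nat) (z : E) (b c : int)
    (s : gal_of {:E}) (g : F)
    (habel : abelian_number_field (fun x : F => iota x%:A))
    (hn : (0 < n)%N) (hz : n.-primitive_root z)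
    (hE : <<1; z>>%VS = {:E}%VS)
    (hb : coprimez b n%:Z) (hs : cyclic_gen s) (hsz : s z = z ^ b)
    (hg : g%:A = z ^ c) :
  (exists v : {rmorphism F -> R[i]}, local_index (cyclic_algebra hs g) v 2) <->
  [/\ forall x : F, iota x%:A \is Num.real, (2 < n)%N & z ^ c = -1].
Proof.
split=> [[v]|real_index].
  exact: (local_index2_only_if (v := v) habel hz hE hg).
exists (iota \o in_alg E : {rmorphism F -> R[i]}).
exact: local_index2_if real_index.
Qed.
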